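(* Let $\mu\colon Z^1(M)\to B^1(M)$ be a homomorphism and $c\geq0$. For all $\varphi\in\mathrm{Ham}(M,\omega)$, $$d_{(\mu,0)}(\mathrm{id},\varphi)\leq d_{(\mu,c)}(\mathrm{id},\varphi)\leq d^B_{(\mu,c)}(\mathrm{id},\varphi)$$ and $$d_{(\mu,0)}(\mathrm{id},\varphi)\leq d^B_{(\mu,0)}(\mathrm{id},\varphi)\leq d^B_{(\mu,c)}(\mathrm{id},\varphi).$$
   Context: $(M,\omega)$ is a closed symplectic manifold; $Z^1(M)$ and $B^1(M)$ are the real vector spaces of closed and exact smooth $1$-forms on $M$. Fix a norm $n^B$ on $B^1(M)$ and a Riemannian metric $g$ on $M$; $\|\cdot\|_{L^2}$ is the $L^2$-norm on $1$-forms induced by $g$. For a homomorphism (linear map) $\mu\colon Z^1(M)\to B^1(M)$ and a real number $c\geq0$, set $n_{(\mu,c)}(\alpha)=n^B(\mu(\alpha))+c\|\alpha-\mu(\alpha)\|_{L^2}$ for $\alpha\in Z^1(M)$. $\mathrm{Symp}_0(M,\omega)$ is the identity component of the group of symplectomorphisms. A (smooth) path $\Psi=\{\psi_t\}_{t\in[0,1]}$ of symplectomorphisms with $\psi_0=\mathrm{id}$ corresponds to the path $\alpha(\Psi)=\{\alpha(\Psi)_t\}_{t\in[0,1]}$ in $Z^1(M)$ given by $\alpha(\Psi)_t=\omega(X_t^\Psi,\cdot)$, where $\partial_t\psi_t=X_t^\Psi(\psi_t)$. $\mathrm{Ham}(M,\omega)$ is the group of endpoints $\psi_1$ of such paths with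 $\alpha(\Psi)_t\in B^1(M)$ for all $t$; such paths are exactly the paths starting at $\mathrm{id}$ and contained in $\mathrm{Ham}(M,\omega)$. The length of $\Psi$ is $\ell_{(\mu,c)}(\Psi)=\int_0^1 n_{(\mu,c)}(\alpha(\Psi)_t)\,dt$. $d_{(\mu,c)}(\mathrm{id},\varphi)$ is the infimum of $\ell_{(\mu,c)}(\Phi)$ over all paths $\Phi$ of symplectomorphisms from $\mathrm{id}$ to $\varphi$; for $\varphi\in\mathrm{Ham}(M,\omega)$, $d^B_{(\mu,c)}(\mathrm{id},\varphi)$ is the infimum of $\ell_{(\mu,c)}(\Phi)$ over all such paths $\Phi$ contained in $\mathrm{Ham}(M,\omega)$. *)

(* Defs.v *)
From HB Require Import structures.
From mathcomp Require Import all_boot all_order all_algebra.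
From mathcomp Require Import all_classical all_reals all_analysis.

Set Implicit Arguments.
Unset Strict Implicit.
Unset Printing Implicit Defensive.

Import Order.TTheory GRing.Theory Num.Theory.
Import numFieldNormedType.Exports.

Local Open Scope classical_set_scope.
Local Open Scope ring_scope.

Section SmoothCalculus.
Context {R : realType}.

Definition partial n (k : 'I_n) (f : 'rV[R]_n -> R) : 'rV[R]_n -> R :=
  'D_(delta_mx 0 k) f.

Definition partials n (s : seq 'I_n) (f : 'rV[R]_n -> R) : 'rV[R]_n -> R :=
  foldr (@partial n) f s.

(* C^oo on U; meaningful for open U, the only case in which it is used *)
Definition smooth_on n (U : set 'rV[R]_n) (f : 'rV[R]_n -> R) : Prop :=
  forall s y, U y ->
    {for y, continuous (partials s f)} /\
    forall k, derivable (partials s f) y (delta_mx 0 k).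

Definition smooth_map_on n m (U : set 'rV[R]_n) (F : 'rV[R]_n -> 'rV[R]_m) :=
  forall k, smooth_on U (fun y => F y 0 k).

(* By Tonelli this is the Lebesgue integral over R^n for Borel f >= 0. *)
Fixpoint integral_Rn n : ('rV[R]_n -> \bar R) -> \bar R :=
  match n with
  | 0 => fun f => f 0
  | n'.+1 => fun f =>
      (\int[lebesgue_measure]_(t in [set: R])
         integral_Rn (fun y : 'rV[R]_n' => f (row_mx (t%:M : 'M[R]_1) y)))%E
  end.

Lemma partials_linear n (U : set 'rV[R]_n) (f g : 'rV[R]_n -> R) a s :
  open U -> smooth_on U f -> smooth_on U g ->
  forall y, U y ->
    partials s (a *: f + g) y = a * partials s f y + partials s g y.
Proof.
move=> oU sf sg; elim: s => [//|k s IH] y Uy /=.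
rewrite /partial.
rewrite (@near_eq_derive _ _ _ _ (a *: partials s f + partials s g))//.
  have [_ df] := sf s y Uy; have [_ dg] := sg s y Uy.
  rewrite deriveD; [|exact/derivableZ/df|exact: dg].
  by rewrite deriveZ; [|exact: df].
by near=> z; apply: IH; near: z; exact: open_nbhs_nbhs.
Unshelve. all: by end_near. Qed.

Lemma smooth_on_linear n (U : set 'rV[R]_n) (f g : 'rV[R]_n -> R) a :
  open U -> smooth_on U f -> smooth_on U g -> smooth_on U (a *: f + g).
Proof.
move=> oU sf sg s y Uy.
have E : \forall z \near y,
    (a *: partials s f + partials s g) z = partials s (a *: f + g) z.
  by near=> z; rewrite (partials_linear a s oU sf sg)//;
    near: z; exact: open_nbhs_nbhs.
have [cf df] := sf s y Uy; have [cg dg] := sg s y Uy.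
split=> [|k].
  rewrite /prop_for /continuous_at -(nbhs_singleton E).
  exact: cvg_trans (near_eq_cvg E) (cvgD (cvgZr cf) cg).
apply: (near_eq_derivable (f := a *: partials s f + partials s g)) => //.
by apply: derivableD; [exact/derivableZ/df|exact: dg].
Unshelve. all: by end_near. Qed.

Lemma smooth_on0 n (U : set 'rV[R]_n) : smooth_on U (0 : 'rV[R]_n -> R).
Proof.
move=> s y _.
have -> : partials s 0 = 0 :> ('rV[R]_n -> R).
  elim: s => //= k s ->; apply/funext => z.
  by rewrite /partial [LHS](derive_cst 0 z).
by split=> [|k]; [exact: cst_continuous|exact: (derivable_cst 0)].
Qed.

End SmoothCalculus.

(* A smooth closed (compact, boundaryless) manifold given by an atlas; second
   countability follows from compactness.  [chartV i] is the inverse of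
   [chart i]; only its values on the image of [dom i] matter. *)
Record closedManifold (R : realType) (n : nat) := ClosedManifold {
  space :> topologicalType;
  space_hausdorff : hausdorff_space space;
  space_compact : compact [set: space];
  idx : Type;
  dom : idx -> set space;
  chart : idx -> space -> 'rV[R]_n;
  chartV : idx -> 'rV[R]_n -> space;
  dom_open : forall i, open (dom i);
  dom_cover : forall x, exists i, dom i x;
  chartK : forall i x, dom i x -> chartV i (chart i x) = x;
  cod_open : forall i, open (chart i @` dom i);
  chart_continuous : forall i x, dom i x -> {for x, continuous (chart i)};
  chartV_continuous : forall i y, (chart i @` dom i) y ->
    {for y, continuous (chartV i)};
  transition_smooth : forall i j,
    smooth_map_on [set y | (chart i @` dom i) y /\ dom j (chartV i y)]
                  (chart j \o chartV i)
}.

Arguments dom {R n c} i.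
Arguments chart {R n c} i.
Arguments chartV {R n c} i.

Section Forms.
Context {R : realType} {n : nat} (M : closedManifold R n).
Implicit Types (i j : idx M).

Definition cod i : set 'rV[R]_n := chart i @` dom i.

Definition overlap i j : set 'rV[R]_n :=
  [set y | cod i y /\ dom j (chartV i y)].

Definition transition i j : 'rV[R]_n -> 'rV[R]_n := chart j \o chartV i.

Definition smooth_fun (f : M -> R) : Prop :=
  forall i, smooth_on (cod i) (f \o chartV i).

(* A covector field in charts: [a i y] is the row of components of the form
   at the point [chartV i y], with respect to the chart i.  Tensor fields are
   represented in the same way below. *)
Definition cofield := idx M -> 'rV[R]_n -> 'rV[R]_n.
HB.instance Definition _ := GRing.Lmodule.on cofield.

(* Rows are tangent vectors, moved by v |-> v *m 'J; hence covectors are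
   pulled back by transposition, and bilinear forms (u, v) |-> u A v^T by
   congruence.  The components vanish off the chart, so that a form has only
   one representation. *)
Definition one_form (a : cofield) : Prop :=
  [/\ forall i, smooth_map_on (cod i) (a i),
      forall i y, ~ cod i y -> a i y = 0 &
      forall i j y, overlap i j y ->
        a i y = a j (transition i j y) *m (jacobian (transition i j) y)^T].

Definition closed_form (a : cofield) : Prop :=
  one_form a /\
  forall i y k l, cod i y ->
    partial k (fun z => a i z 0 l) y = partial l (fun z => a i z 0 k) y.

Definition dform (f : M -> R) : cofield := fun i y =>
  if y \in cod i then \row_k partial k (f \o chartV i) y else 0.

Definition exact_form (a : cofield) : Prop :=
  exists2 f, smooth_fun f & a = dform f.

Definition Z1_pred : {pred cofield} := [pred a | `[< closed_form a >]].
Definition B1_pred : {pred cofield} := [pred a | `[< exact_form a >]].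

Let coordE (r : R) (a b : cofield) i k :
  (fun y => (r *: a + b) i y 0 k) =
  r *: (fun y => a i y 0 k) + (fun y => b i y 0 k) :> ('rV[R]_n -> R).
Proof. by apply/funext => y; rewrite !mxE. Qed.

Let cofieldE (r : R) (a b : cofield) i y :
  (r *: a + b) i y = r *: a i y + b i y.
Proof. by []. Qed.

Let coord0 i k : (fun y => (0 : cofield) i y 0 k) = 0 :> ('rV[R]_n -> R).
Proof. by apply/funext => y; rewrite !mxE. Qed.

Lemma Z1_submod_closed : submod_closed Z1_pred.
Proof.
split=> [|r a b /asboolP[[sa za ca] da] /asboolP[[sb zb cb] db]]; apply/asboolP.
  split; first split=> //.
  - by move=> i k; rewrite coord0; exact: smooth_on0.
  - by move=> i j y _; rewrite mul0mx.
  - by move=> i y k l _; rewrite !coord0 /partial (derive_cst 0 y)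
      (derive_cst 0 y).
split; first split.
- by move=> i k; rewrite coordE; apply: smooth_on_linear;
    [exact: cod_open|exact: sa|exact: sb].
- by move=> i y yi; rewrite cofieldE za// zb// scaler0 addr0.
- move=> i j y yij; rewrite cofieldE (ca i j)// (cb i j)//.
  by rewrite scalemxAl -mulmxDl.
- move=> i y k l yi; rewrite !coordE.
  have E u v := partials_linear r [:: u] (@cod_open _ _ M i) (sa i v) (sb i v) yi.
  rewrite [LHS]E [RHS]E.
  by congr (_ * _ + _); [exact: da|exact: db].
Qed.

Lemma B1_submod_closed : submod_closed B1_pred.
Proof.
split=> [|r _ _ /asboolP[f sf ->] /asboolP[h sh ->]]; apply/asboolP.
  exists 0; first by move=> i; exact: smooth_on0.
  apply/funext => i; apply/funext => y; rewrite /dform; case: ifP => // _.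
  by apply/rowP => k; rewrite !mxE /partial (derive_cst 0 y).
exists (r *: f + h).
  by move=> i; apply: (@smooth_on_linear _ _ _ (f \o chartV i) (h \o chartV i));
    [exact: cod_open|exact: sf|exact: sh].
apply/funext => i; apply/funext => y.
rewrite cofieldE /dform.
case: ifPn => [/set_mem yi|_]; last by rewrite scaler0 addr0.
apply/rowP => k; rewrite !mxE.
by rewrite -(partials_linear r [:: k] (@cod_open _ _ M i) (sf i) (sh i) yi).
Qed.

HB.instance Definition _ := GRing.isSubmodClosed.Build R cofield Z1_pred
  Z1_submod_closed.
HB.instance Definition _ := GRing.isSubmodClosed.Build R cofield B1_pred
  B1_submod_closed.

Record Z1 := MkZ1 { Z1_val :> cofield; _ : Z1_val \in Z1_pred }.
HB.instance Definition _ := [isSub for Z1_val].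
HB.instance Definition _ := [Choice of Z1 by <:].
HB.instance Definition _ := [SubChoice_isSubLmodule of Z1 by <:].

Record B1 := MkB1 { B1_val :> cofield; _ : B1_val \in B1_pred }.
HB.instance Definition _ := [isSub for B1_val].
HB.instance Definition _ := [Choice of B1 by <:].
HB.instance Definition _ := [SubChoice_isSubLmodule of B1 by <:].

End Forms.

Arguments cod {R n M} i.
Arguments overlap {R n M} i j.
Arguments transition {R n M} i j.

Definition tensor2 R n (M : closedManifold R n)
    (A : idx M -> 'rV[R]_n -> 'M[R]_n) : Prop :=
  (forall i k l, smooth_on (cod i) (fun y => A i y k l)) /\
  forall i j y, overlap i j y ->
    let J := jacobian (transition i j) y in
    A i y = J *m A j (transition i j y) *m J^T.

Record symplecticForm R n (M : closedManifold R n) := SymplecticForm {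
  symp_coef :> idx M -> 'rV[R]_n -> 'M[R]_n;
  symp_tensor : tensor2 symp_coef;
  symp_skew : forall i y, cod i y -> (symp_coef i y)^T = - symp_coef i y;
  symp_closed : forall i y j k l, cod i y ->
    partial j (fun z => symp_coef i z k l) y +
    partial k (fun z => symp_coef i z l j) y +
    partial l (fun z => symp_coef i z j k) y = 0;
  symp_nondegenerate : forall i y, cod i y -> symp_coef i y \in unitmx
}.

Record riemannianMetric R n (M : closedManifold R n) := RiemannianMetric {
  metric_coef :> idx M -> 'rV[R]_n -> 'M[R]_n;
  metric_tensor : tensor2 metric_coef;
  metric_sym : forall i y, cod i y -> (metric_coef i y)^T = metric_coef i y;
  metric_pos : forall i y (v : 'rV[R]_n), cod i y -> v != 0 ->
    0 < (v *m metric_coef i y *m v^T) 0 0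
}.

Record normOn (R : realType) (V : lmodType R) := NormOn {
  norm_fun :> V -> R;
  norm_eq0 : forall v, norm_fun v = 0 -> v = 0;
  norm_scale : forall a v, norm_fun (a *: v) = `|a| * norm_fun v;
  norm_triangle : forall u v, norm_fun (u + v) <= norm_fun u + norm_fun v
}.

Section L2Norm.
Context {R : realType} {n : nat} {M : closedManifold R n}.

Record partitionOfUnity := PartitionOfUnity {
  pu_size : nat;
  pu_chart : 'I_pu_size -> idx M;
  pu_fun : 'I_pu_size -> M -> R;
  pu_smooth : forall m, smooth_fun (pu_fun m);
  pu_ge0 : forall m x, 0 <= pu_fun m x;
  pu_support : forall m,
    closure [set x | pu_fun m x != 0] `<=` dom (pu_chart m);
  pu_sum1 : forall x, \sum_m pu_fun m x = 1
}.

(* Integral against the Riemannian volume of the function that reads [f i] in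
   the chart i *)
Definition integral_with (g : riemannianMetric M) (f : idx M -> 'rV[R]_n -> R)
    (P : partitionOfUnity) : \bar R :=
  (\sum_(m < pu_size P)
    let i := pu_chart m in
    integral_Rn (fun y => if y \in cod i then
      (pu_fun m (chartV i y) * f i y * Num.sqrt (\det (g i y)))%:E else 0))%E.

(* [integral_with] does not depend on the partition of unity. *)
Definition integral_vol (g : riemannianMetric M) (f : idx M -> 'rV[R]_n -> R) :
  \bar R := xget 0%E (range (integral_with g f)).

Definition sqnorm_form (g : riemannianMetric M) (a : cofield M) :
    idx M -> 'rV[R]_n -> R :=
  fun i y => (a i y *m invmx (g i y) *m (a i y)^T) 0 0.

Definition L2norm (g : riemannianMetric M) (a : cofield M) : R :=
  Num.sqrt (fine (integral_vol g (sqnorm_form g a))).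

End L2Norm.

Section Paths.
Context {R : realType} {n : nat} {M : closedManifold R n}.
Variable omega : symplecticForm M.

Definition smooth_self (phi : M -> M) : Prop :=
  continuous phi /\
  forall i j, smooth_map_on [set y | cod i y /\ dom j (phi (chartV i y))]
                            (chart j \o phi \o chartV i).

Definition preserves_symp (phi : M -> M) : Prop :=
  forall i j x, dom i x -> dom j (phi x) ->
    let J := jacobian (chart j \o phi \o chartV i) (chart i x) in
    J *m omega j (chart j (phi x)) *m J^T = omega i (chart i x).

Definition symplectomorphism (phi : M -> M) : Prop :=
  [/\ smooth_self phi,
      exists2 psi, smooth_self psi & cancel phi psi /\ cancel psi phi &
      preserves_symp phi].

(* Smoothness of (t, x) |-> psi t x on [0, 1] x M: in charts the map extends
   smoothly to a neighborhood of each point of [0, 1] x M in R x M; rows of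
   size 1 + n hold the pairs (t, y). *)
Definition smooth_isotopy (psi : R -> M -> M) : Prop :=
  forall t0 x0 i j, 0 <= t0 <= 1 -> dom i x0 -> dom j (psi t0 x0) ->
  exists (W : set 'rV[R]_(1 + n)) (F : 'rV[R]_(1 + n) -> 'rV[R]_n),
    [/\ open W, W (row_mx t0%:M (chart i x0)), smooth_map_on W F &
        forall t y, W (row_mx t%:M y) -> 0 <= t <= 1 -> cod i y ->
          dom j (psi t (chartV i y)) /\
          chart j (psi t (chartV i y)) = F (row_mx t%:M y)].

(* Only the values psi t with 0 <= t <= 1 matter. *)
Definition symp_path (psi : R -> M -> M) : Prop :=
  [/\ psi 0 = id, smooth_isotopy psi &
      forall t, 0 <= t <= 1 -> symplectomorphism (psi t)].

(* The t-derivative of psi in the chart j is v at time t (one-sided if t is 0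
   or 1). *)
Definition velocity (psi : R -> M -> M) j (t : R) (x : M) (v : 'rV[R]_n) :=
  (fun h : R => h^-1 *: (chart j (psi (t + h) x) - chart j (psi t x)))
    @ within [set h | 0 <= t + h <= 1] 0^' --> v.

(* a t = omega(X_t, _) for 0 <= t <= 1, where X_t (psi t x) is the velocity;
   this determines a t, and such an a exists for every symp_path. *)
Definition path_form (psi : R -> M -> M) (a : R -> Z1 M) : Prop :=
  forall t x j, 0 <= t <= 1 -> dom j (psi t x) ->
    exists2 v, velocity psi j t x v &
      Z1_val (a t) j (chart j (psi t x)) = v *m omega j (chart j (psi t x)).

Definition Ham (phi : M -> M) : Prop :=
  exists psi a, [/\ symp_path psi, path_form psi a,
    forall t, 0 <= t <= 1 -> exact_form (a t) & psi 1 = phi].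

Variables (g : riemannianMetric M) (nB : normOn (B1 M)).

Definition norm_mu (mu : {linear Z1 M -> B1 M}) (c : R) (a : Z1 M) : R :=
  nB (mu a) + c * L2norm g (Z1_val a - B1_val (mu a)).

(* The integral of a nonnegative function is a supremum over simple functions
   below it, hence makes sense (possibly as +oo) for arbitrary mu and nB. *)
Definition path_length (mu : {linear Z1 M -> B1 M}) (c : R) (a : R -> Z1 M) :
    \bar R :=
  (\int[lebesgue_measure]_(t in `[0%R, 1%R]) (norm_mu mu c (a t))%:E)%E.

Definition dist_id (mu : {linear Z1 M -> B1 M}) (c : R) (phi : M -> M) :
    \bar R :=
  ereal_inf [set l | exists psi a, [/\ symp_path psi, path_form psi a,
    psi 1 = phi & l = path_length mu c a]].

Definition distB_id (mu : {linear Z1 M -> B1 M}) (c : R) (phi : M -> M) :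
    \bar R :=
  ereal_inf [set l | exists psi a, [/\ symp_path psi, path_form psi a,
    forall t, 0 <= t <= 1 -> Ham (psi t),
    psi 1 = phi & l = path_length mu c a]].

End Paths.

(* Main.v *)
Require Import Defs.
From HB Require Import structures.
From mathcomp Require Import all_boot all_order all_algebra.
From mathcomp Require Import all_classical all_reals all_analysis.

(** Two monotonicity principles give the four inequalities.  Raising [c] from
    [0] adds the nonnegative term [c * L2norm _] to the integrand, so the length
    of each single path increases, and with it the infimum over any fixed class
    of paths; this compares [0] with [c] for both distances.  A path contained
    in the Hamiltonian group is in particular a path of symplectomorphisms, so
    for fixed [c] the distance [distB_id] is an infimum over a smaller set than
    [dist_id].

    The only delicate point is that [t |-> norm_mu mu c (a t)] need not be
    measurable, since [mu] and [nB] are arbitrary.  The integral of a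
    nonnegative function is nevertheless monotone, being a supremum over the
    simple functions below the integrand ([ge0_le_integral_nonmeasurable]). *)

Set Implicit Arguments.
Unset Strict Implicit.
Unset Printing Implicit Defensive.

Import Order.TTheory GRing.Theory Num.Theory.

Local Open Scope ring_scope.

(** A simple function below the smaller integrand is also below the larger one,
    so the supremum defining the smaller integral runs over fewer simple
    functions. *)
Lemma ge0_le_integral_nonmeasurable (d : measure_display)
    (T : measurableType d) (R : realType) (m : {measure set T -> \bar R})
    (D : set T) (f1 f2 : T -> \bar R) :
  (forall x, D x -> (0 <= f1 x)%E) -> (forall x, D x -> (f1 x <= f2 x)%E) ->
  (\int[m]_(x in D) f1 x <= \int[m]_(x in D) f2 x)%E.
Proof.
move=> f10 f12; have f20 x (Dx : D x) := le_trans (f10 x Dx) (f12 x Dx).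
rewrite !ge0_integralE//; apply: ereal_sup_le => _ /= [h hf1 <-].
exists h => //= x; apply: (le_trans (hf1 x)).
by rewrite /patch; case: ifPn => // /set_mem; exact: f12.
Qed.

Lemma normOn_ge0 (R : realType) (V : lmodType R) (N : normOn V) (v : V) :
  0 <= N v.
Proof.
have N0 : N 0 = 0 by rewrite -(scale0r 0) norm_scale normr0 mul0r.
have NN : N (- v) = N v by rewrite -scaleN1r norm_scale normrN normr1 mul1r.
have := norm_triangle N v (- v).
by rewrite subrr N0 NN -mulr2n pmulrn_lge0.
Qed.

Section MonotoneInTheWeight.
Context {R : realType} {n : nat} {M : closedManifold R n}.
Variables (omega : symplecticForm M) (g : riemannianMetric M).
Variables (nB : normOn (B1 M)) (mu : {linear Z1 M -> B1 M}).
Implicit Types (c : R) (a : Z1 M) (phi : M -> M).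

Lemma norm_mu_ge0 c a : 0 <= c -> 0 <= norm_mu g nB mu c a.
Proof.
by move=> c0; rewrite addr_ge0 ?normOn_ge0// mulr_ge0// sqrtr_ge0.
Qed.

Lemma norm_mu_le c c' a :
  c <= c' -> norm_mu g nB mu c a <= norm_mu g nB mu c' a.
Proof. by move=> cc'; rewrite lerD2l ler_wpM2r// sqrtr_ge0. Qed.

Lemma path_length_le c c' (a : R -> Z1 M) : 0 <= c -> c <= c' ->
  (path_length g nB mu c a <= path_length g nB mu c' a)%E.
Proof.
move=> c0 cc'; apply: ge0_le_integral_nonmeasurable => t _; rewrite lee_fin.
  exact: norm_mu_ge0.
exact: norm_mu_le.
Qed.

Lemma dist_id_le c c' phi : 0 <= c -> c <= c' ->
  (dist_id omega g nB mu c phi <= dist_id omega g nB mu c' phi)%E.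
Proof.
move=> c0 cc'; apply: le_ereal_inf_tmp => _ [psi [a [sp pf e ->]]].
apply: le_trans (path_length_le a c0 cc').
by apply: ereal_inf_lbound; exists psi, a.
Qed.

Lemma distB_id_le c c' phi : 0 <= c -> c <= c' ->
  (distB_id omega g nB mu c phi <= distB_id omega g nB mu c' phi)%E.
Proof.
move=> c0 cc'; apply: le_ereal_inf_tmp => _ [psi [a [sp pf ham e ->]]].
apply: le_trans (path_length_le a c0 cc').
by apply: ereal_inf_lbound; exists psi, a.
Qed.

Lemma dist_id_le_distB_id c phi :
  (dist_id omega g nB mu c phi <= distB_id omega g nB mu c phi)%E.
Proof.
by apply: ereal_inf_le_tmp => _ [psi [a [sp pf _ e ->]]]; exists psi, a.
Qed.

End MonotoneInTheWeight.

Theorem proposition2p5 (R : realType) (n : nat) (M : closedManifold R n)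
    (omega : symplecticForm M) (g : riemannianMetric M) (nB : normOn (B1 M))
    (mu : {linear Z1 M -> B1 M}) (c : R) (hc : 0 <= c)
    (phi : M -> M) (hphi : Ham omega phi) :
  ((dist_id omega g nB mu 0 phi <= dist_id omega g nB mu c phi)%E /\
   (dist_id omega g nB mu c phi <= distB_id omega g nB mu c phi)%E) /\
  ((dist_id omega g nB mu 0 phi <= distB_id omega g nB mu 0 phi)%E /\
   (distB_id omega g nB mu 0 phi <= distB_id omega g nB mu c phi)%E).
Proof.
split; split.
- exact: dist_id_le.
- exact: dist_id_le_distB_id.
- exact: dist_id_le_distB_id.
- exact: distB_id_le.
Qed.
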